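(* A modular category $\mathcal{C}$ with a group $G$ of invertible objects splits as a disjoint union of subcategories $\{\mathcal{C}_\alpha\}_{\alpha\in G}$ (where $G$ is identified with its group of characters $\widehat G$ and written additively) such that: - each $\mathcal{C}_\alpha$ is a full subcategory of $\mathcal{C}$; - each object of $\mathcal{C}$ belongs to $\mathcal{C}_\alpha$ for a unique $\alpha$; - $\mathrm{Hom}_{\mathcal{C}}(\mathcal{C}_\alpha,\mathcal{C}_\beta)=0$ if $\alpha\neq\beta$; - for $U\in\mathcal{C}_\alpha$ and $V\in\mathcal{C}_\beta$, $U\otimes V\in\mathcal{C}_{\alpha+\beta}$; - $\mathbf 1\in\mathcal{C}_0$, and for $U\in\mathcal{C}_\alpha$, $U^*\in\mathcal{C}_{-\alpha}$.
   Context: A ribbon category is a (strict) monoidal category with braiding $b$, twist $\theta$ and compatible duality. Let $\mathbf{k}$ be a field of characteristic zero. A modular category over $\mathbf{k}$ is a $\mathbf{k}$-linear ribbon category $\mathcal{C}$ (Hom sets are $\mathbf{k}$-vector spaces, composition and tensor product are bilinear, $\mathrm{End}(\mathbf 1)=\mathbf{k}$) with a finite set $\Gamma$ of simple objects ($\lambda$ is simple if $\mathbf{k}\to\mathrm{End}(\lambda)$, $u\mapsto u\cdot\mathrm{id}_\lambda$, is an isomorphism) such that: $\mathbf 1\in\Gamma$; the dual of each $\lambda\in\Gamma$ is isomorphic to an object of $\Gamma$; for every object $V$ there is a finite decomposition $\mathrm{id}_V=\sum_i f_i\,\mathrm{id}_{\lambda_i}\,g_i$ with $\lambda_i\in\Gamma$;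 and the matrix $(S_{\lambda\mu})_{\lambda,\mu\in\Gamma}$ is invertible, where $S_{\lambda\mu}$ is the invariant of the $0$-framed Hopf link with linking number $+1$ coloured by $\lambda,\mu$. Objects are identified with their isomorphism classes. An object $\lambda\in\Gamma$ is invertible if there is an object $\nu\in\Gamma$ with $\lambda\otimes\nu\cong\mathbf 1$; $G\subset\Gamma$ is the finite abelian group (under $\otimes$) of isomorphism classes of invertible simple objects, and $\widehat G=\mathrm{Hom}(G,\mathbb{C}^* )$ is its group of characters. For $\lambda\in\Gamma$ and $g\in G$ the double braiding of $\lambda$ with $g$ is multiplication by a scalar $\chi_\lambda(g)$, which is a root of unity, and $\chi_\lambda\in\widehat G$; moreover $\chi_{\lambda\otimes\mu}=\chi_\lambda\chi_\mu$. By taking a logarithm of the character, $\widehat G$ is identified with $G$ and its group operation is written additively. The splitting is the one given by this map: a simple object $\lambda$ lies in $\mathcal{C}_\alpha$ when $\chi_\lambda$ corresponds to $\alpha$.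
   Formalization: ''Each object belongs to a unique C_α'' fails for zero objects and sums of simple objects of different degrees; stated instead: a unique α for simple objects, at most one for nonzero objects, and for every object a unique decomposition of its identity into parts through the C_α. *)

(* Defs.v *)
From mathcomp Require Import all_boot all_algebra.

Set Implicit Arguments.
Unset Strict Implicit.
Unset Printing Implicit Defensive.

Import GRing.Theory.
Local Open Scope ring_scope.

Declare Scope cat_scope.
Delimit Scope cat_scope with cat.
Local Open Scope cat_scope.

Reserved Notation "g \oc f" (at level 50, left associativity).
Reserved Notation "U \ox V" (at level 40, left associativity).
Reserved Notation "f \om g" (at level 40, left associativity).

(** * k-linear ribbon categories *)

Record linearCategory (k : fieldType) := LinearCategory {
  ob :> Type;
  mor : ob -> ob -> lmodType k;
  idm : forall U, mor U U;
  compm : forall U V W, mor V W -> mor U V -> mor U W;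
  comp1m : forall U V (f : mor U V), compm (idm V) f = f;
  compm1 : forall U V (f : mor U V), compm f (idm U) = f;
  compA : forall U V W X (h : mor W X) (g : mor V W) (f : mor U V),
    compm h (compm g f) = compm (compm h g) f;
  comp_linearr : forall U V W (g : mor V W), linear (@compm U V W g);
  comp_linearl : forall U V W (f : mor U V),
    linear (fun g : mor V W => compm g f)
}.
Arguments mor {k} {l} U V.
Arguments idm {k} {l} U.
Arguments compm {k l U V W} g f.
Notation "g \oc f" := (compm g f) : cat_scope.

(** Strict monoidal categories are those in which the associator and the
    unitors are identities; no strictness is imposed here. *)
Record monoidalCategory (k : fieldType) := MonoidalCategory {
  mon_cat :> linearCategory k;
  tens : mon_cat -> mon_cat -> mon_cat;
  tensm : forall (U U' V V' : mon_cat),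
    mor U U' -> mor V V' -> mor (tens U V) (tens U' V');
  tens_id : forall U V, tensm (idm U) (idm V) = idm (tens U V);
  tens_comp : forall U U' U'' V V' V''
      (f' : mor U' U'') (f : mor U U') (g' : mor V' V'') (g : mor V V'),
    tensm (f' \oc f) (g' \oc g) = tensm f' g' \oc tensm f g;
  tens_linearr : forall U U' V V' (f : mor U U'), linear (@tensm U U' V V' f);
  tens_linearl : forall U U' V V' (g : mor V V'),
    linear (fun f : mor U U' => tensm f g);
  unit_ob : mon_cat;
  assoc : forall U V W, mor (tens (tens U V) W) (tens U (tens V W));
  associ : forall U V W, mor (tens U (tens V W)) (tens (tens U V) W);
  assocK : forall U V W, associ U V W \oc assoc U V W = idm _;
  associK : forall U V W, assoc U V W \oc associ U V W = idm _;
  assoc_nat : forall U U' V V' W W'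
      (f : mor U U') (g : mor V V') (h : mor W W'),
    assoc U' V' W' \oc tensm (tensm f g) h
    = tensm f (tensm g h) \oc assoc U V W;
  lunit : forall U, mor (tens unit_ob U) U;
  luniti : forall U, mor U (tens unit_ob U);
  lunitK : forall U, luniti U \oc lunit U = idm _;
  lunitiK : forall U, lunit U \oc luniti U = idm _;
  lunit_nat : forall U V (f : mor U V),
    lunit V \oc tensm (idm unit_ob) f = f \oc lunit U;
  runit : forall U, mor (tens U unit_ob) U;
  runiti : forall U, mor U (tens U unit_ob);
  runitK : forall U, runiti U \oc runit U = idm _;
  runitiK : forall U, runit U \oc runiti U = idm _;
  runit_nat : forall U V (f : mor U V),
    runit V \oc tensm f (idm unit_ob) = f \oc runit U;
  pentagon : forall U V W X,
    assoc U V (tens W X) \oc assoc (tens U V) W X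
    = tensm (idm U) (assoc V W X) \oc assoc U (tens V W) X
      \oc tensm (assoc U V W) (idm X);
  triangle : forall U V,
    tensm (idm U) (lunit V) \oc assoc U unit_ob V = tensm (runit U) (idm V)
}.
Arguments tens {k} {m} U V.
Arguments tensm {k m U U' V V'} f g.
Arguments unit_ob {k} m.
Arguments assoc {k} {m} U V W.
Arguments associ {k} {m} U V W.
Arguments lunit {k} {m} U.
Arguments luniti {k} {m} U.
Arguments runit {k} {m} U.
Arguments runiti {k} {m} U.
Notation "U \ox V" := (tens U V) : cat_scope.
Notation "f \om g" := (tensm f g) : cat_scope.

Record ribbonCategory (k : fieldType) := RibbonCategory {
  rib_cat :> monoidalCategory k;
  (* braiding *)
  braid : forall U V : rib_cat, mor (U \ox V) (V \ox U);
  braidi : forall U V : rib_cat, mor (V \ox U) (U \ox V);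
  braidK : forall U V, braidi U V \oc braid U V = idm _;
  braidiK : forall U V, braid U V \oc braidi U V = idm _;
  braid_nat : forall (U U' V V' : rib_cat) (f : mor U U') (g : mor V V'),
    braid U' V' \oc (f \om g) = (g \om f) \oc braid U V;
  hexagonr : forall U V W,
    assoc V W U \oc braid U (V \ox W) \oc assoc U V W
    = (idm V \om braid U W) \oc assoc V U W \oc (braid U V \om idm W);
  hexagonl : forall U V W,
    associ W U V \oc braid (U \ox V) W \oc associ U V W
    = (braid U W \om idm V) \oc associ U W V \oc (idm U \om braid V W);
  (* twist *)
  twist : forall U : rib_cat, mor U U;
  twisti : forall U : rib_cat, mor U U;
  twistK : forall U, twisti U \oc twist U = idm U;
  twistiK : forall U, twist U \oc twisti U = idm U;
  twist_nat : forall (U V : rib_cat) (f : mor U V),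
    twist V \oc f = f \oc twist U;
  twist_tens : forall U V : rib_cat,
    twist (U \ox V) = braid V U \oc braid U V \oc (twist U \om twist V);
  (* duality *)
  dual : rib_cat -> rib_cat;
  coev : forall U, mor (unit_ob rib_cat) (U \ox dual U);
  ev : forall U, mor (dual U \ox U) (unit_ob rib_cat);
  zigzag : forall U,
    runit U \oc (idm U \om ev U) \oc assoc U (dual U) U
    \oc (coev U \om idm U) \oc luniti U = idm U;
  zigzag_dual : forall U,
    lunit (dual U) \oc (ev U \om idm (dual U)) \oc associ (dual U) U (dual U)
    \oc (idm (dual U) \om coev U) \oc runiti (dual U) = idm (dual U);
  twist_dual : forall U,
    (twist U \om idm (dual U)) \oc coev U
    = (idm U \om twist (dual U)) \oc coev U
}.
Arguments braid {k} {r} U V.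
Arguments twist {k} {r} U.
Arguments dual {k} {r} U.
Arguments coev {k} {r} U.
Arguments ev {k} {r} U.

Section Notions.
Variable k : fieldType.

Definition isomorphic (C : linearCategory k) (U V : C) : Prop :=
  exists (f : mor U V) (g : mor V U), g \oc f = idm U /\ f \oc g = idm V.

Definition simple (C : linearCategory k) (U : C) : Prop :=
  bijective (fun u : k => u *: idm U).

(** [e] is a finite sum of endomorphisms of [V] each of which factors through
    an object satisfying [P]. *)
Definition factors_through (C : linearCategory k) (P : C -> Prop) (V : C)
    (e : mor V V) : Prop :=
  exists (m : nat) (W : 'I_m -> C)
         (f : forall i, mor (W i) V) (g : forall i, mor V (W i)),
    (forall i, P (W i)) /\ e = \sum_(i < m) (f i \oc idm (W i) \oc g i).

Definition double_braiding (C : ribbonCategory k) (U V : C) :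
    mor (U \ox V) (U \ox V) :=
  braid V U \oc braid U V.

(** Quantum trace, an endomorphism of the unit object. *)
Definition qtrace (C : ribbonCategory k) (V : C) (f : mor V V) :
    mor (unit_ob C) (unit_ob C) :=
  ev V \oc braid V (dual V) \oc ((twist V \oc f) \om idm (dual V)) \oc coev V.

(** The Hopf link with linking number +1 is the closure of the pure braid on
    two parallel strands made of two positive crossings. *)
Definition hopf_link (C : ribbonCategory k) (U V : C) :
    mor (unit_ob C) (unit_ob C) :=
  qtrace (double_braiding U V).

Record subcategory (C : linearCategory k) := Subcategory {
  sub_ob :> C -> Prop;
  sub_hom : forall U V : C, mor U V -> Prop;
  sub_id : forall U, sub_ob U -> sub_hom (idm U);
  sub_comp : forall U V W (g : mor V W) (f : mor U V),
    sub_ob U -> sub_ob V -> sub_ob W ->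
    sub_hom g -> sub_hom f -> sub_hom (g \oc f)
}.

Definition is_full (C : linearCategory k) (D : subcategory C) : Prop :=
  forall (U V : C) (f : mor U V), D U -> D V -> sub_hom D f.

Definition full_subcategory (C : linearCategory k) (P : C -> Prop) :
    subcategory C :=
  @Subcategory C P (fun _ _ _ => True) (fun _ _ => I)
    (fun _ _ _ _ _ _ _ _ _ _ => I).

End Notions.

(** * Modular categories *)

(** [Gamma] is a finite family indexed by ['I_rank]; its members are pairwise
    non-isomorphic because isomorphic members would give equal rows of the
    invertible matrix [S]. *)
Record modularCategory (k : fieldType) := ModularCategory {
  mod_cat :> ribbonCategory k;
  rank : nat;
  Gamma : 'I_rank -> mod_cat;
  unit_simple : simple (unit_ob mod_cat);
  Gamma_simple : forall i, simple (Gamma i);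
  Gamma_one : exists i, Gamma i = unit_ob mod_cat;
  Gamma_dual : forall i, exists j, isomorphic (dual (Gamma i)) (Gamma j);
  Gamma_domination : forall V : mod_cat,
    factors_through (fun W => exists i, W = Gamma i) (idm V);
  Gamma_nondegenerate : exists S : 'M[k]_rank,
    (forall i j, hopf_link (Gamma i) (Gamma j) = S i j *: idm (unit_ob mod_cat))
    /\ S \in unitmx
}.

Section Splitting.
Variables (k : fieldType) (C : modularCategory k).

Definition invertible (i : 'I_(rank C)) : Prop :=
  exists j : 'I_(rank C), isomorphic (Gamma i \ox Gamma j) (unit_ob C).

(** The group, written additively, of isomorphism classes of invertible objects
    of [Gamma]: its elements are in bijection with these objects, and its
    operation is the tensor product. *)
Record invertibleGroup := InvertibleGroup {
  inv_carrier :> finZmodType;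
  inv_index : inv_carrier -> 'I_(rank C);
  inv_index_inj : injective inv_index;
  inv_indexP : forall i, invertible i <-> exists g, inv_index g = i;
  inv_indexD : forall g h,
    isomorphic (Gamma (inv_index (g + h)))
               (Gamma (inv_index g) \ox Gamma (inv_index h))
}.

Variables (K : fieldType) (G : invertibleGroup).

Definition inv_obj (g : G) : C := Gamma (inv_index g).

(** The values of the characters [chi_lambda] are #|G|-th roots of unity in
    [k]; [iota] is used to see them as complex numbers. *)
Definition root_embedding (n : nat) (iota : k -> K) : Prop :=
  [/\ iota 1 = 1,
      forall x y, x ^+ n = 1 -> y ^+ n = 1 -> iota (x * y) = iota x * iota y
    & forall x y, x ^+ n = 1 -> y ^+ n = 1 -> iota x = iota y -> x = y].

Definition character (chi : G -> K) : Prop :=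
  (forall g, chi g != 0) /\ (forall g h, chi (g + h) = chi g * chi h).

(** [psi] is a group isomorphism from [G] onto its group of characters. *)
Definition character_identification (psi : G -> G -> K) : Prop :=
  [/\ forall a, character (psi a),
      forall a b g, psi (a + b) g = psi a g * psi b g,
      forall a b, psi a =1 psi b -> a = b
    & forall chi, character chi -> exists a, psi a =1 chi].

(** [chi] is the function [g |-> chi_U(g)]. *)
Definition braiding_character (U : C) (chi : G -> k) : Prop :=
  forall g, double_braiding U (inv_obj g) = chi g *: idm (U \ox inv_obj g).

Definition has_degree (iota : k -> K) (psi : G -> G -> K) (a : G) (U : C) :
    Prop :=
  exists chi : G -> k,
    braiding_character U chi /\ forall g, iota (chi g) = psi a g.

(** The full subcategory [C_a], whose objects are the finite sums of simple
    objects of degree [a]. A zero object is an empty sum and lies in every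
    [C_a]; a direct sum of simple objects of different degrees lies in none. *)
Definition component (iota : k -> K) (psi : G -> G -> K) (a : G) :
    subcategory C :=
  full_subcategory (fun V : C =>
    factors_through (fun U => simple U /\ has_degree iota psi a U) (idm V)).

End Splitting.

(* Main.v *)
Require Import Defs.
From mathcomp Require Import all_boot all_order all_algebra.
From mathcomp Require Import reals complex.
Set Implicit Arguments.
Unset Strict Implicit.
Unset Printing Implicit Defensive.
Import GRing.Theory.
Local Open Scope ring_scope.
Local Open Scope cat_scope.

(** The degree of an object is read off from its double braidings with the
    invertible objects, and the splitting is the resulting grading.

    Tensoring with an invertible object [X] is faithful, so for [U] simple every
    endomorphism of [U \ox X], in particular the double braiding, is a scalar
    ([simple_tens_invertible]). The hexagons make these scalars multiplicative in
    both arguments ([double_braiding_tens], [double_braidingC]); they therefore form a character of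
    [G] with values in the roots of unity, and the identification of [G] with its
    characters gives every simple object a degree ([has_degree_exists]) that is
    additive under the tensor product ([has_degree_tens]).

    The double braiding is natural, so a morphism between objects of different
    degrees intertwines two different scalars and vanishes ([has_degree_hom0]).
    Everything else follows from this vanishing and from the domination of [C] by
    [Gamma]. An object belongs to the component of degree [a] as soon as it
    receives no nonzero morphism from simple objects of other degrees
    ([component_of_hom0]). This applies to a tensor product of simple objects, and
    to [dual U] because a morphism [W -> dual U] is the same thing as a morphism
    [W \ox U -> 1], whose target has degree [0]. Finally, the decomposition of an
    object into homogeneous parts is obtained by sorting a decomposition of its
    identity by degree; it is unique because parts of different degrees compose
    to zero. *)

(** * Bilinearity of composition and tensor product *)

Section LinearMaps.
Variables (k : fieldType) (V W : lmodType k) (f : V -> W).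
Hypothesis f_lin : linear f.

Lemma linear_map0 : f 0 = 0.
Proof. by have := f_lin (-1) 0 0; rewrite !scaleN1r !addNr. Qed.

Lemma linear_mapZ a x : f (a *: x) = a *: f x.
Proof. by have := f_lin a x 0; rewrite linear_map0 !addr0. Qed.

Lemma linear_map_sum (I : finType) (P : pred I) (F : I -> V) :
  f (\sum_(i | P i) F i) = \sum_(i | P i) f (F i).
Proof.
apply: (big_morph f _ linear_map0) => x y.
by have := f_lin 1 x y; rewrite !scale1r.
Qed.

End LinearMaps.

Section Bilinearity.
Variable k : fieldType.

Section Composition.
Variables (C : linearCategory k) (U V W : C).

Lemma compm0 (g : mor V W) : g \oc (0 : mor U V) = 0.
Proof. exact: (linear_map0 (comp_linearr g)). Qed.

Lemma comp0m (f : mor U V) : (0 : mor V W) \oc f = 0.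
Proof. exact: (linear_map0 (comp_linearl f)). Qed.

Lemma compmZr a (g : mor V W) (f : mor U V) : g \oc (a *: f) = a *: (g \oc f).
Proof. exact: (linear_mapZ (comp_linearr g)). Qed.

Lemma compmZl a (g : mor V W) (f : mor U V) : (a *: g) \oc f = a *: (g \oc f).
Proof. exact: (linear_mapZ (comp_linearl f)). Qed.

Lemma compm_sumr (I : finType) (P : pred I) (g : mor V W) (F : I -> mor U V) :
  g \oc (\sum_(i | P i) F i) = \sum_(i | P i) (g \oc F i).
Proof. exact: (linear_map_sum (comp_linearr g)). Qed.

Lemma compm_suml (I : finType) (P : pred I) (F : I -> mor V W) (f : mor U V) :
  (\sum_(i | P i) F i) \oc f = \sum_(i | P i) (F i \oc f).
Proof. exact: (linear_map_sum (comp_linearl f)). Qed.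

End Composition.

Section Tensor.
Variables (C : monoidalCategory k) (U U' V V' : C).

Lemma tens0m (g : mor V V') : (0 : mor U U') \om g = 0.
Proof. exact: (linear_map0 (tens_linearl g)). Qed.

Lemma tensmZl a (f : mor U U') (g : mor V V') : (a *: f) \om g = a *: (f \om g).
Proof. exact: (linear_mapZ (tens_linearl g)). Qed.

Lemma tensmZr a (f : mor U U') (g : mor V V') : f \om (a *: g) = a *: (f \om g).
Proof. exact: (linear_mapZ (tens_linearr f)). Qed.

Lemma tensm_sumr (I : finType) (f : mor U U') (F : I -> mor V V') :
  f \om (\sum_i F i) = \sum_i (f \om F i).
Proof. exact: (linear_map_sum (tens_linearr f)). Qed.

Lemma tensm_suml (I : finType) (F : I -> mor U U') (g : mor V V') :
  (\sum_i F i) \om g = \sum_i (F i \om g).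
Proof. exact: (linear_map_sum (tens_linearl g)). Qed.

End Tensor.
End Bilinearity.

(** * Endomorphisms factoring through a class of objects *)

Section Factorisation.
Variables (k : fieldType) (C : linearCategory k).
Implicit Types (P Q : C -> Prop) (U V W : C).

Lemma isomorphic_sym U V : isomorphic U V -> isomorphic V U.
Proof. by case=> f [g [gf fg]]; exists g, f. Qed.

Lemma simple_neq0 U : simple U -> idm U <> 0.
Proof.
case=> h hK _ U0; have /eqP : 1 = 0 :> k by rewrite -[LHS]hK -[RHS]hK U0 !scaler0.
by rewrite oner_eq0.
Qed.

Lemma factors_through1 P V W (f : mor W V) (g : mor V W) :
  P W -> factors_through P (f \oc g).
Proof.
move=> PW; exists 1, (fun=> W), (fun=> f), (fun=> g); split=> //.
by rewrite big_ord1 compm1.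
Qed.

Lemma factors_through0 P V : factors_through P (0 : mor V V).
Proof.
by exists 0, (fun=> V), (fun=> 0), (fun=> 0); split=> [[]//|]; rewrite big_ord0.
Qed.

Lemma factors_throughD P V (e e' : mor V V) :
  factors_through P e -> factors_through P e' -> factors_through P (e + e').
Proof.
move=> [m [W [f [g [PW ->]]]]] [m' [W' [f' [g' [PW' ->]]]]].
(* The two families are concatenated as one family of triples (W, f, g). *)
pose T := {X : C & (mor X V * mor V X)%type}.
pose F (i : 'I_(m + m')) : T := match split i with
  | inl j => existT _ (W j) (f j, g j) | inr j => existT _ (W' j) (f' j, g' j) end.
exists (m + m')%N, (fun i => projT1 (F i)), (fun i => (projT2 (F i)).1),
  (fun i => (projT2 (F i)).2); split=> [i|].
  by rewrite /F; case: split.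
rewrite big_split_ord /=; congr (_ + _); apply: eq_bigr => i _; rewrite /F.
- by rewrite (unsplitK (inl i)).
- by rewrite (unsplitK (inr i)).
Qed.

Lemma factors_through_sum P V (I : finType) (A : pred I) (F : I -> mor V V) :
  (forall i, A i -> factors_through P (F i)) ->
  factors_through P (\sum_(i | A i) F i).
Proof.
move=> PF; apply: big_ind => //; first exact: factors_through0.
exact: factors_throughD.
Qed.

Lemma factors_through_trans P Q V (e : mor V V) :
    (forall W, Q W -> factors_through P (idm W)) ->
  factors_through Q e -> factors_through P e.
Proof.
move=> QP [m [W [f [g [QW ->]]]]]; apply: factors_through_sum => i _.
have [n [X [u [v [PX ->]]]]] := QP _ (QW i).
rewrite compm_sumr compm_suml; apply: factors_through_sum => j _.
by rewrite compm1 Defs.compA -Defs.compA; apply: factors_through1.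
Qed.

Lemma factors_through_hom0 P Q U V (p : mor U U) (q : mor V V) (f : mor U V) :
    (forall A B (h : mor A B), P A -> Q B -> h = 0) ->
  factors_through P p -> factors_through Q q -> q \oc f \oc p = 0.
Proof.
move=> PQ0 [m [W [u [v [PW ->]]]]] [n [X [s [t [QX ->]]]]].
rewrite !compm_suml big1 // => j _; rewrite compm_sumr big1 // => i _.
have h0 := PQ0 _ _ (t j \oc f \oc u i) (PW i) (QX j).
by rewrite !compm1 !Defs.compA -(Defs.compA _ _ f) -(Defs.compA _ _ (u i)) h0 compm0 comp0m.
Qed.

End Factorisation.

Lemma factors_through_tens (k : fieldType) (C : monoidalCategory k)
    (P Q : C -> Prop) (U V : C) (p : mor U U) (q : mor V V) :
    factors_through P p -> factors_through Q q ->
  factors_through (fun W => exists A B, [/\ P A, Q B & W = A \ox B]) (p \om q).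
Proof.
move=> [m [W [u [v [PW ->]]]]] [n [X [s [t [QX ->]]]]].
rewrite tensm_suml; apply: factors_through_sum => i _.
rewrite tensm_sumr; apply: factors_through_sum => j _.
by rewrite !compm1 tens_comp; apply: factors_through1; exists (W i), (X j).
Qed.

(** * Tensoring with invertible objects, and duality *)

Section Monoidal.
Variables (k : fieldType) (C : monoidalCategory k).
Implicit Types U V W X Y : C.

(** The associator and the unitor conjugate [(h \om idm X) \om idm Y] to [h]. *)
Lemma tensm_invertible_inj X Y U V (h : mor U V) :
  isomorphic (X \ox Y) (unit_ob C) -> h \om idm X = 0 -> h = 0.
Proof.
case=> f [g [_ fg]] hX0.
have hXY0 : h \om idm (X \ox Y) = 0.
  rewrite -[LHS]compm1 -(associK U X Y) Defs.compA -tens_id -assoc_nat hX0.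
  by rewrite tens0m compm0 comp0m.
have h10 : h \om idm (unit_ob C) = 0.
  have -> : h \om idm (unit_ob C)
          = (idm V \om f) \oc (h \om idm (X \ox Y)) \oc (idm U \om g).
    by rewrite -!tens_comp comp1m !compm1 fg.
  by rewrite hXY0 compm0 comp0m.
by rewrite -[h]compm1 -(runitiK U) Defs.compA -runit_nat h10 compm0 comp0m.
Qed.

Lemma tens_invertible_neq0 X Y U :
  isomorphic (X \ox Y) (unit_ob C) -> idm U <> 0 -> idm (U \ox X) <> 0.
Proof.
move=> XY U0 UX0; apply: U0; apply: (tensm_invertible_inj XY).
by rewrite tens_id.
Qed.

(** Tensoring an endomorphism of [U \ox X] with [Y] gives an endomorphism of an
    object isomorphic to [U], hence a scalar; tensoring with [Y] loses nothing
    because [Y] is invertible as well. *)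
Lemma simple_tens_invertible X Y U (f : mor (U \ox X) (U \ox X)) :
    isomorphic (X \ox Y) (unit_ob C) -> isomorphic (Y \ox X) (unit_ob C) ->
  simple U -> exists c, f = c *: idm (U \ox X).
Proof.
move=> [u [v [vu uv]]] YX [h hK Kh].
pose p := runit U \oc (idm U \om u) \oc assoc U X Y.
pose q := associ U X Y \oc (idm U \om v) \oc runiti U.
have qp : q \oc p = idm _.
  rewrite /q /p !Defs.compA -(Defs.compA _ (runiti U)) runitK compm1.
  rewrite -(Defs.compA _ (idm U \om v)) -tens_comp vu comp1m tens_id compm1.
  exact: assocK.
(* Otherwise reassociation would unfold p and q. *)
clearbody p q; pose c := h (p \oc (f \om idm Y) \oc q).
exists c; apply/eqP; rewrite -subr_eq0; apply/eqP.
apply: (tensm_invertible_inj YX).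
suff fY : f \om idm Y = c *: idm _.
  have := tens_linearl (idm Y) (- c) (idm (U \ox X)) f.
  by rewrite fY tens_id !scaleNr addNr addrC => ->.
have E : p \oc (f \om idm Y) \oc q = c *: idm U by rewrite Kh.
have : q \oc (p \oc (f \om idm Y) \oc q) \oc p = c *: idm _.
  by rewrite E compmZr compm1 compmZl qp.
by rewrite !Defs.compA qp comp1m -Defs.compA qp compm1.
Qed.

End Monoidal.

(** The zigzag identity recovers [h] from its adjoint
    [ev U \oc (h \om idm U)]. *)
Lemma ev_adjoint_inj (k : fieldType) (C : ribbonCategory k) (U W : C)
    (h : mor W (dual U)) :
  ev U \oc (h \om idm U) = 0 -> h = 0.
Proof.
move=> h0; rewrite -[h]comp1m -(zigzag_dual U) -!Defs.compA.
have -> : runiti (dual U) \oc h = (h \om idm (unit_ob C)) \oc runiti W.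
  rewrite -[RHS]comp1m -(runitK (dual U)) -Defs.compA (Defs.compA (runit _)) runit_nat.
  by rewrite -(Defs.compA h) runitiK compm1.
rewrite (Defs.compA (idm _ \om coev U)) -tens_comp comp1m compm1.
rewrite -[h in h \om coev U]compm1 -[coev U]comp1m tens_comp -Defs.compA.
rewrite (Defs.compA (associ _ _ _)).
have -> : associ (dual U) U (dual U) \oc (h \om idm (U \ox dual U))
   = ((h \om idm U) \om idm (dual U)) \oc associ W U (dual U).
  rewrite -[LHS]compm1 -(associK W U (dual U)) -tens_id Defs.compA.
  by rewrite -(Defs.compA _ _ (assoc _ _ _)) -assoc_nat !Defs.compA assocK comp1m.
rewrite -Defs.compA (Defs.compA (ev U \om _)) -tens_comp h0 tens0m.
by rewrite comp0m compm0.
Qed.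

(** * The double braiding *)

Section DoubleBraiding.
Variables (k : fieldType) (C : ribbonCategory k).
Implicit Types U V W : C.

Lemma double_braiding_nat U U' V V' (f : mor U U') (g : mor V V') :
  double_braiding U' V' \oc (f \om g) = (f \om g) \oc double_braiding U V.
Proof.
by rewrite /double_braiding -Defs.compA braid_nat Defs.compA braid_nat Defs.compA.
Qed.

(** Conjugation by the braiding exchanges the two double braidings. *)
Lemma double_braidingC U V c :
    double_braiding U V = c *: idm (U \ox V) ->
  double_braiding V U = c *: idm (V \ox U).
Proof.
move=> dUV; rewrite -[LHS]compm1 -(braidiK U V) {1}/double_braiding.
rewrite !Defs.compA -(Defs.compA _ (braid V U)) -/(double_braiding U V).
by rewrite dUV compmZr compm1 compmZl braidiK.
Qed.

Lemma double_braiding_iso U U' V c : isomorphic U U' ->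
    double_braiding U V = c *: idm (U \ox V) ->
  double_braiding U' V = c *: idm (U' \ox V).
Proof.
case=> f [g [_ fg]] dUV; rewrite -[LHS]compm1 -tens_id -fg.
rewrite -[idm V]compm1 tens_comp Defs.compA double_braiding_nat dUV.
by rewrite compmZr compm1 compmZl.
Qed.

(** The two hexagons pull [W] around [U] and around [V] separately. *)
Lemma double_braiding_tens U V W c d :
    double_braiding U W = c *: idm (U \ox W) ->
    double_braiding V W = d *: idm (V \ox W) ->
  double_braiding (U \ox V) W = (c * d) *: idm ((U \ox V) \ox W).
Proof.
move=> dU dV; have hr := hexagonr W U V; have hl := hexagonl U V W.
have E : assoc U V W \oc double_braiding (U \ox V) W \oc associ U V W
  = (c * d) *: idm _.
  transitivity ((assoc U V W \oc braid W (U \ox V) \oc assoc W U V) \oc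
     (associ W U V \oc braid (U \ox V) W \oc associ U V W)).
    rewrite /double_braiding !Defs.compA -(Defs.compA _ (assoc W U V)).
    by rewrite associK compm1.
  rewrite hr hl !Defs.compA -(Defs.compA _ (braid W U \om _)) -tens_comp -/(double_braiding U W).
  rewrite dU tensmZl compmZr !compmZl comp1m tens_id compm1.
  rewrite -(Defs.compA _ (assoc _ _ _)) associK compm1 -tens_comp comp1m.
  by rewrite -/(double_braiding V W) dV tensmZr tens_id scalerA.
(* The double braiding is made opaque: reassociation would unfold it. *)
move: (double_braiding _ W) E => D E.
rewrite -[LHS]comp1m -(assocK U V W) -[LHS]compm1 -(assocK U V W).
rewrite !Defs.compA -(Defs.compA (associ U V W)) -(Defs.compA (associ U V W)) E.
by rewrite compmZr compm1 compmZl.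
Qed.

(** Naturality of the double braiding equates [c *: (h \om idm X)] with
    [d *: (h \om idm X)], and tensoring with [X] is faithful. *)
Lemma double_braiding_hom0 X Y U V c d (h : mor U V) :
    isomorphic (X \ox Y) (unit_ob C) ->
    double_braiding U X = c *: idm (U \ox X) ->
    double_braiding V X = d *: idm (V \ox X) ->
  c != d -> h = 0.
Proof.
move=> XY dU dV cd; apply: (tensm_invertible_inj XY).
have := double_braiding_nat h (idm X); rewrite dU dV compmZl compmZr comp1m compm1.
move/eqP; rewrite -subr_eq0 -scalerBl scaler_eq0 subr_eq0 eq_sym (negPf cd).
by move/eqP.
Qed.

End DoubleBraiding.

(** * The grading by braiding characters *)

Section BraidingCharacters.
Variables (k : fieldType) (C : modularCategory k) (G : invertibleGroup C).
Implicit Types (U V W : C) (g h : G) (chi : G -> k).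

Lemma inv_obj_inverse g : exists Y : C,
  isomorphic (inv_obj g \ox Y) (unit_ob C)
  /\ isomorphic (Y \ox inv_obj g) (unit_ob C).
Proof.
have [_ /(_ (ex_intro _ g erefl)) [j gj]] := inv_indexP G (inv_index g).
exists (Gamma j); split=> //; have [f [f' [f'f ff']]] := gj.
exists (f \oc braid (Gamma j) (inv_obj g)), (braidi (Gamma j) (inv_obj g) \oc f').
split; rewrite Defs.compA.
- by rewrite -(Defs.compA _ f') f'f compm1 braidK.
- by rewrite -(Defs.compA f) braidiK compm1.
Qed.

Lemma tens_inv_obj_neq0 g U : idm U <> 0 -> idm (U \ox inv_obj g) <> 0.
Proof. by have [Y [gY _]] := inv_obj_inverse g; apply: tens_invertible_neq0 gY. Qed.

Lemma tens_inv_obj_scale_inj g U (c d : k) : idm U <> 0 ->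
  c *: idm (U \ox inv_obj g) = d *: idm (U \ox inv_obj g) -> c = d.
Proof.
move=> /(@tens_inv_obj_neq0 g) U0 /eqP; rewrite -subr_eq0 -scalerBl scaler_eq0.
by rewrite subr_eq0 => /orP[] /eqP.
Qed.

Lemma braiding_character_exists U :
  simple U -> exists chi, @braiding_character k C G U chi.
Proof.
move=> sU; apply: (fin_all_exists (P := fun g c =>
  double_braiding U (inv_obj g) = c *: idm (U \ox inv_obj g))) => g.
have [Y [gY Yg]] := inv_obj_inverse g.
exact: (simple_tens_invertible _ gY Yg sU).
Qed.

Section OneObject.
Variables (U : C) (chi : G -> k).
Hypotheses (U0 : idm U <> 0) (chiU : braiding_character U chi).

Lemma braiding_characterD g h : chi (g + h) = chi g * chi h.
Proof.
apply: (@tens_inv_obj_scale_inj (g + h) U) => //; rewrite -chiU.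
apply: double_braidingC.
apply: (double_braiding_iso (isomorphic_sym (inv_indexD g h))).
by apply: double_braiding_tens; apply/double_braidingC/chiU.
Qed.

Lemma braiding_character_neq0 g : chi g != 0.
Proof.
apply/eqP => chi0; apply: (tens_inv_obj_neq0 (g := g) U0).
have := chiU g; rewrite chi0 scale0r /double_braiding => d0.
rewrite -(braidK U (inv_obj g)) -[braid U _]comp1m -(braidK (inv_obj g) U).
by rewrite -!Defs.compA d0 !compm0.
Qed.

Lemma braiding_character0 : chi 0 = 1.
Proof.
apply: (mulfI (braiding_character_neq0 0)).
by rewrite mulr1 -braiding_characterD addr0.
Qed.

(** Translation by [g] permutes [G] and multiplies the nonzero product of all
    values of [chi] by [chi g ^+ #|G|]. *)
Lemma braiding_character_unity g : chi g ^+ #|G| = 1.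
Proof.
have P0 : \prod_(h : G) chi h != 0.
  by apply/prodf_neq0 => h _; apply: braiding_character_neq0.
apply: (mulIf P0); rewrite mul1r [RHS](reindex_inj (addrI g)) /=.
under [RHS]eq_bigr do rewrite braiding_characterD.
by rewrite big_split prodr_const.
Qed.

End OneObject.
End BraidingCharacters.

Section Grading.
Variables (k K : fieldType) (C : modularCategory k) (G : invertibleGroup C).
Variables (iota : k -> K) (psi : G -> G -> K).
Hypotheses (iotaP : root_embedding #|G| iota)
           (psiP : character_identification psi).
Implicit Types (U V W : C) (a b : G).

Local Notation deg := (has_degree iota psi).
Local Notation CC := (component iota psi).

Lemma has_degree_exists U : simple U -> exists a, deg a U.
Proof.
move=> sU; have U0 := simple_neq0 sU.
have [chi chiU] := braiding_character_exists G sU.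
have [iota1 iotaM _] := iotaP; have [_ _ _ psi_onto] := psiP.
have unity := braiding_character_unity U0 chiU.
have chiM g h : iota (chi (g + h)) = iota (chi g) * iota (chi h).
  by rewrite (braiding_characterD U0 chiU) iotaM.
have chi_char : character (fun g => iota (chi g)).
  split=> // g; apply/eqP => chi0; have /eqP := chiM g (- g).
  by rewrite chi0 mul0r addrN (braiding_character0 U0 chiU) iota1 oner_eq0.
have [a psia] := psi_onto _ chi_char.
by exists a, chi; split=> // g; rewrite psia.
Qed.

Lemma has_degree_iso a U V : isomorphic U V -> deg a U -> deg a V.
Proof.
move=> UV [chi [chiU chia]]; exists chi; split=> // g.
exact: double_braiding_iso UV (chiU g).
Qed.

(** Multiplicativity of the embedding is available at roots of unity only, and
    the values of the characters of nonzero objects are such roots. *)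
Lemma has_degree_tens a b U V : idm U <> 0 -> idm V <> 0 ->
  deg a U -> deg b V -> deg (a + b) (U \ox V).
Proof.
move=> U0 V0 [chi [chiU chia]] [eta [etaV etab]].
have [_ iotaM _] := iotaP; have [_ psiD _ _] := psiP.
exists (fun g => chi g * eta g); split=> g; first exact: double_braiding_tens.
rewrite psiD -chia -etab iotaM //; first exact: braiding_character_unity chiU g.
exact: braiding_character_unity etaV g.
Qed.

Lemma has_degree_hom0 a b U V (f : mor U V) :
  a <> b -> deg a U -> deg b V -> f = 0.
Proof.
move=> ab [chi [chiU chia]] [eta [etaV etab]]; have [_ _ psi_inj _] := psiP.
have [/forallP psiab|] := boolP [forall g, psi a g == psi b g].
  by case: ab; apply: psi_inj => g; apply/eqP.
rewrite negb_forall => /existsP[g ne_g]; have [Y [gY _]] := inv_obj_inverse g.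
apply: (double_braiding_hom0 f gY (chiU g) (etaV g)).
by apply: contra ne_g => /eqP e; rewrite -chia -etab e.
Qed.

Lemma has_degree_uniq a b U : idm U <> 0 -> deg a U -> deg b U -> a = b.
Proof.
move=> U0 aU bU; apply/eqP/negPn/negP => /eqP ab; apply: U0.
exact: has_degree_hom0 ab aU bU.
Qed.

(** The degree [a] of the unit object satisfies [a + a = a], the unit object
    being isomorphic to its square. *)
Lemma has_degree_unit : deg 0 (unit_ob C).
Proof.
have s1 := @unit_simple k C; have one0 := simple_neq0 s1.
have [a a1] := has_degree_exists s1.
suff a0 : a = 0 by rewrite a0 in a1.
apply: (addrI a); rewrite addr0; apply: (has_degree_uniq one0 _ a1).
apply: has_degree_iso (has_degree_tens one0 one0 a1 a1).
by exists (lunit _), (luniti _); rewrite lunitK lunitiK.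
Qed.

Lemma component_simple a U : simple U -> deg a U -> CC a U.
Proof.
move=> sU aU; rewrite /= -[idm U]compm1.
exact: factors_through1.
Qed.

(** In a decomposition of the identity through the objects of [Gamma] only those
    of degree [a] contribute a nonzero term. *)
Lemma component_of_hom0 a V :
    (forall b W (f : mor W V), a <> b -> simple W -> deg b W -> f = 0) ->
  CC a V.
Proof.
move=> hom0; have [m [W [f [g [GW idV]]]]] := Gamma_domination V; rewrite /= idV.
apply: factors_through_sum => i _; rewrite compm1.
have [j Wj] := GW i; have sW : simple (W i) by rewrite Wj; apply: Gamma_simple.
have [b bW] := has_degree_exists sW.
have [ab|/eqP ab] := eqVneq a b; first by apply: factors_through1; rewrite ab.
by rewrite (hom0 b _ (f i)) // comp0m; apply: factors_through0.
Qed.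

Lemma component_of_degree a V : deg a V -> CC a V.
Proof.
move=> aV; apply: component_of_hom0 => b W f ab _ bW.
by apply: has_degree_hom0 bW aV => ba; apply: ab.
Qed.

Lemma component_hom0 a b U V (f : mor U V) :
  a <> b -> CC a U -> CC b V -> f = 0.
Proof.
move=> ab aU bV; rewrite -[f]comp1m -[LHS]compm1.
apply: factors_through_hom0 aU bV => A B h [_ aA] [_ bB].
exact: has_degree_hom0 ab aA bB.
Qed.

Lemma component_uniq a b U : idm U <> 0 -> CC a U -> CC b U -> a = b.
Proof.
move=> U0 aU bU; apply/eqP/negPn/negP => /eqP ab; apply: U0.
exact: component_hom0 ab aU bU.
Qed.

Lemma component_tens a b U V : CC a U -> CC b V -> CC (a + b) (U \ox V).
Proof.
move=> aU bV; have := factors_through_tens aU bV; rewrite tens_id.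
apply: factors_through_trans => _ [A [B [[sA aA] [sB bB] ->]]].
by apply: component_of_degree; apply: has_degree_tens => //; apply: simple_neq0.
Qed.

(** A morphism [f] from [W] of degree [b] to [dual U] is determined by
    [ev U \oc (f \om idm U)], which goes from degree [b + a] to degree [0]. *)
Lemma component_dual a U : CC a U -> CC (- a) (dual U).
Proof.
move=> aU; apply: component_of_hom0 => b W f ab sW bW.
have baWU := component_tens (component_simple sW bW) aU.
have one0 := component_of_degree has_degree_unit.
apply: ev_adjoint_inj; apply: (component_hom0 _ _ baWU one0).
by move=> ba; apply: ab; apply/eqP; rewrite eq_sym -addr_eq0 ba.
Qed.

Lemma component_simple_exists U : simple U -> exists a, CC a U.
Proof.
move=> sU; have [a aU] := has_degree_exists sU; exists a.
exact: component_simple.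
Qed.

Lemma component_decomposition V : exists e : {ffun G -> mor V V},
  (forall a, factors_through (CC a) (e a)) /\ idm V = \sum_a e a.
Proof.
have [m [W [f [g [GW idV]]]]] := Gamma_domination V.
have degW i : exists a, CC a (W i).
  apply: component_simple_exists; have [j ->] := GW i.
  exact: Gamma_simple.
have [d dW] := fin_all_exists degW.
exists [ffun a => \sum_(i | d i == a) (f i \oc idm (W i) \oc g i)]; split=> [a|].
  rewrite ffunE; apply: factors_through_sum => i /eqP <-; rewrite compm1.
  exact: factors_through1.
by rewrite idV (partition_big d predT) //=; apply: eq_bigr => a _; rewrite ffunE.
Qed.

(** Terms of different degrees of two decompositions of the identity compose to
    zero, so both families equal the products of their terms of equal degree. *)
Lemma component_decomposition_uniq V (e e' : {ffun G -> mor V V}) :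
    (forall a, factors_through (CC a) (e a)) -> idm V = \sum_a e a ->
    (forall a, factors_through (CC a) (e' a)) -> idm V = \sum_a e' a ->
  e = e'.
Proof.
move=> eC eV e'C e'V; apply/ffunP => a.
have orth b c : b <> c -> e' c \oc e b = 0.
  move=> bc; rewrite -[e' c]compm1; apply: factors_through_hom0 (eC b) (e'C c).
  by move=> A B h bA cB; apply: component_hom0 bc bA cB.
have -> : e a = e' a \oc e a.
  rewrite -[LHS]comp1m e'V compm_suml (bigD1 a) //= big1 ?addr0 // => c /eqP ca.
  by apply: orth => ac; apply: ca.
rewrite -[RHS]compm1 eV compm_sumr (bigD1 a) //= [X in _ + X]big1 ?addr0 //.
by move=> c /eqP ca; apply: orth.
Qed.

End Grading.

Theorem mainTheorem4 (R : realType) (k : fieldType) (hk : [pchar k] =i pred0)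
    (C : modularCategory k) (G : invertibleGroup C)
    (iota : k -> R[i]) (hiota : root_embedding #|G| iota)
    (psi : G -> G -> R[i]) (hpsi : character_identification psi) :
  let CC := component iota psi in
  (forall a (U : C), simple U -> CC a U <-> has_degree iota psi a U)
  /\ (forall a, is_full (CC a))
  /\ ((forall U : C, simple U -> exists! a, CC a U)
      /\ (forall (V : C) a b, idm V <> 0 -> CC a V -> CC b V -> a = b)
      /\ (forall V : C, exists! e : {ffun G -> mor V V},
            (forall a, factors_through (CC a) (e a))
            /\ idm V = \sum_a e a))
  /\ (forall a b (U V : C) (f : mor U V),
        a <> b -> CC a U -> CC b V -> f = 0)
  /\ (forall a b (U V : C), CC a U -> CC b V -> CC (a + b) (U \ox V))
  /\ CC 0 (unit_ob C)
  /\ (forall a (U : C), CC a U -> CC (- a) (dual U)).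
Proof.
move=> CC; have uniqC := component_uniq hpsi; have hom0 := component_hom0 hpsi.
split=> [a U sU|].
  split; last exact: component_simple.
  move=> aU; have [b bU] := has_degree_exists hiota hpsi sU.
  by rewrite (uniqC _ _ _ _ (simple_neq0 sU) aU (component_simple sU bU)).
split=> //; split; last first.
  split=> [a b U V f|]; first exact: hom0.
  split=> [a b U V|]; first exact: component_tens.
  split=> [|a U]; last exact: component_dual.
  exact/component_of_degree/has_degree_unit.
split=> [U sU|].
  have [a aU] := component_simple_exists hiota hpsi sU; exists a; split=> // b.
  exact: uniqC (simple_neq0 sU) aU.
split=> [V a b|V]; first exact: uniqC.
have [e [eC eV]] := component_decomposition hiota hpsi V.
exists e; split=> // e' [e'C e'V].
exact: (component_decomposition_uniq hpsi).
Qed.
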